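(* For any $n\ge1$, $$\sum_{\pi\in\mathfrak{S}_n(213)}(-1)^{\mathsf{exc}\,\pi}=\sum_{\pi\in\mathfrak{S}_n(132)}(-1)^{\mathsf{exc}\,\pi}=\begin{cases}0,&n\text{ even},\\(-1)^{(n-1)/2}C_{(n-1)/2},&n\text{ odd},\end{cases}$$ $$\sum_{\pi\in\mathfrak{D}_n(213)}(-1)^{\mathsf{exc}\,\pi}=\sum_{\pi\in\mathfrak{D}_n(132)}(-1)^{\mathsf{exc}\,\pi}=\begin{cases}(-1)^{n/2}C_{n/2},&n\text{ even},\\0,&n\text{ odd}.\end{cases}$$
   Context: $C_m=\frac{1}{m+1}\binom{2m}{m}$ is the Catalan number. $\mathfrak{S}_n(\tau)$: permutations of $[n]$ avoiding classical pattern $\tau$; $\mathfrak{D}_n(\tau)$: those with no fixed point (derangements). $\mathsf{exc}\,\pi=\#\{i:\pi(i)>i\}$. *)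

(* Defs.v *)
From mathcomp Require Import all_boot all_order all_algebra all_fingroup.
Set Implicit Arguments. Unset Strict Implicit. Unset Printing Implicit Defensive.
Import GRing.Theory Num.Theory.

(* Permutations of [n] are modelled as {perm 'I_n}, i.e. of {0,...,n-1};
   the order on positions/values is the usual one, so pattern containment,
   fixed points and excedances are unaffected by the shift by one. *)

(* Classical pattern containment: a pattern tau is a sequence of naturals
   (a permutation of 0..k-1, 0-indexed, e.g. 213 is [:: 1; 0; 2]).
   pi contains tau if there are positions i_0 < ... < i_{k-1} such that
   pi(i_a) < pi(i_b) <-> tau_a < tau_b for all a, b. *)
Definition contains_pattern (n : nat) (tau : seq nat) (pi : {perm 'I_n}) : bool :=
  [exists idx : (size tau).-tuple 'I_n,
     sorted (fun i j : 'I_n => (i < j)%N) idx &&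
     [forall a : 'I_(size tau), forall b : 'I_(size tau),
        ((pi (tnth idx a) < pi (tnth idx b))%N ==
         (nth 0 tau a < nth 0 tau b)%N)]].

Definition avoids (n : nat) (tau : seq nat) (pi : {perm 'I_n}) : bool :=
  ~~ contains_pattern tau pi.

Definition pat213 : seq nat := [:: 1; 0; 2].
Definition pat132 : seq nat := [:: 0; 2; 1].

Definition exc (n : nat) (pi : {perm 'I_n}) : nat :=
  #|[set i : 'I_n | (i < pi i)%N]|.

Definition derangement (n : nat) (pi : {perm 'I_n}) : bool :=
  [forall i : 'I_n, pi i != i].

Definition catalan (m : nat) : nat := 'C(m.*2, m) %/ m.+1.

Definition sgn_exc_sum (n : nat) (tau : seq nat) : int :=
  \sum_(pi : {perm 'I_n} | avoids tau pi) (-1) ^+ exc pi.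

Definition sgn_exc_sum_der (n : nat) (tau : seq nat) : int :=
  \sum_(pi : {perm 'I_n} | avoids tau pi && derangement pi) (-1) ^+ exc pi.

(* Main.v *)
Require Import Defs.
From mathcomp Require Import all_boot all_order all_algebra all_fingroup.
From mathcomp Require Import zify ring.
Import GRing.Theory Num.Theory.

(** The involution sending pi to the inverse of its reverse-complement exchanges
    the patterns 213 and 132 and preserves excedances and fixed points, so only
    132 matters.

    Compare the values of a 132-avoider with a shifted diagonal: the weight of
    pi is the product over i of w(pi(i) + c, i + d), where w(a, b) is -1 if
    a > b, x if a = b and 1 if a < b.  With c = d the values x = 1 and x = 0
    give the two signed sums of the theorem.  Splitting at the maximum gives a
    quadratic recurrence in which one factor of each term is a signed Catalan
    number, hence a linear equation for the generating function
    P(y, z) = sum P_ij y^i z^j, where n = (i + j) / 2 and c - d = (i - j) / 2.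
    Let u = y (1 - u^2), v = z (1 + v^2), and let W be P with its coefficients
    multiplied by w(i, j); the equation reads
      P = (1 - u^2) (1 + y z W) (1 + v^2).
    For Q_m = (u^m + u^(m-1) v + ... + v^m) P it implies
      Q_m = y (Q_(m-1) - Q_(m+1)) + (terms with i < j)             (m > 0),
      Q_m = z (Q_(m-1) + Q_(m+1)) + (terms with i >= j)            (m > 0),
    so the diagonal coefficients D_m(n) = [y^n z^n] Q_(2m) satisfy
    D_m(n + 1) = D_(m-1)(n) - D_(m+1)(n) for m > 0 and
    D_0(n + 1) = x D_0(n) - D_1(n): these are signed ballot recurrences. *)

(** * Splitting 132-avoiding words at their maximum *)

Section Decomposition.
Local Open Scope ring_scope.

(* [a] is a value and [b] the position it is compared with. *)
Definition exc_weight (x : int) (a b : nat) : int :=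
  if (b < a)%N then -1 else if a == b then x else 1.

(** Separate shifts [c] of the values and [d] of the positions keep everything in [nat]: a left part
    raises [c], a right part raises [d]. *)
Fixpoint word_weight (x : int) (c d : nat) (s : seq nat) : int :=
  if s is v :: s' then exc_weight x (v + c) d * word_weight x c d.+1 s' else 1.

Fixpoint av132 (s : seq nat) : bool :=
  if s is v :: s' then pairwise (fun y z => ~~ (v < z < y)%N) s' && av132 s'
  else true.

Definition av_words (n : nat) : seq (seq nat) :=
  [seq s <- permutations (iota 0 n) | av132 s].

Definition shifted_sum (x : int) (n c d : nat) : int :=
  \sum_(s <- av_words n) word_weight x c d s.

Lemma word_weight_cat x c d s t :
  word_weight x c d (s ++ t) =
  word_weight x c d s * word_weight x c (d + size s) t.
Proof.
elim: s d => [|v s IHs] d /=; first by rewrite mul1r addn0.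
by rewrite IHs mulrA addSnnS.
Qed.

Lemma word_weight_map x c d k s :
  word_weight x c d [seq (k + v)%N | v <- s] = word_weight x (k + c) d s.
Proof. by elim: s d => [|v s IHs] d //=; rewrite IHs addnCA addnA. Qed.

Lemma word_weight_shift x c d e s :
  word_weight x (c + e) (d + e) s = word_weight x c d s.
Proof.
elim: s d => [|v s IHs] d //=.
by rewrite -addSn IHs /exc_weight addnA ltn_add2r eqn_add2r.
Qed.

Lemma word_weight_low x n c d s :
  all (gtn n) s -> (n + c <= d)%N -> word_weight x c d s = 1.
Proof.
elim: s d => [|v s IHs] d //= /andP[vn sn] nd.
rewrite IHs //; last by lia.
by rewrite /exc_weight; case: ltnP => [|_]; [lia | case: eqP => //; lia].
Qed.

Lemma word_weight_high x c d s :
  (d + size s <= c)%N -> word_weight x c d s = (-1) ^+ size s.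
Proof.
elim: s d => [|v s IHs] d //= nd.
rewrite IHs; last by lia.
by rewrite /exc_weight exprS; case: ltnP => //; lia.
Qed.

Lemma av132_map k s : av132 [seq (k + v)%N | v <- s] = av132 s.
Proof.
elim: s => [|v s IHs] //=; rewrite IHs pairwise_map.
by congr (_ && _); apply: eq_pairwise => y z /=; rewrite !ltn_add2l.
Qed.

(** With [m] between them, a letter of [L] and a larger letter of [R] form a 132. Conversely, when
    [L] lies above [R], no 132 starting in [L] can end at [m] or in [R], so each pattern stays
    inside one part. *)
Lemma av132_split (m : nat) (L R : seq nat) :
    all (gtn m) L -> all (gtn m) R -> uniq (L ++ R) ->
  av132 (L ++ m :: R) =
  [&& av132 L, av132 R & allrel (fun l r => (r < l)%N) L R].
Proof.
elim: L => [|v L IHL] /=.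
  move=> _ mR _; rewrite andbC; case: av132 => //=.
  apply/(pairwiseP 0%N) => i j _; rewrite inE => jR _ /=.
  by have /allP/(_ _ (mem_nth 0%N jR)) /= := mR; lia.
move=> /andP[vm Lm] mR /andP[vLR uLR].
rewrite IHL // pairwise_cat allrel_consl.
case: (boolP (all _ R)) => [vR|]; last first.
  move=> nR; rewrite /= !andbF.
  apply/negbTE/negP => /andP[/and3P[_ _ /andP[/allP H _]] _].
  case/negP: nR; apply/allP => r rR.
  have := H _ rR; have /allP/(_ _ rR) /= := mR.
  have : v != r by apply: contraNneq vLR => ->; rewrite mem_cat rR orbT.
  by lia.
have Hv r : r \in R -> (r < v)%N by move/(allP vR).
have -> : allrel (fun y z => ~~ (v < z < y)%N) L (m :: R).
  apply/allrelP => y z yL; rewrite inE => /predU1P[->|/Hv]; last by lia.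
  by have /allP/(_ _ yL) /= := Lm; lia.
have -> : pairwise (fun y z => ~~ (v < z < y)%N) (m :: R).
  apply/(pairwiseP 0%N) => i [|j]; rewrite !inE // => _ jR _ /=.
  by rewrite ltnNge ltnW // Hv // mem_nth.
by rewrite andbT /= !andbA.
Qed.

Lemma perm_iota_max n (L R : seq nat) :
  perm_eq (L ++ n :: R) (iota 0 n.+1) = perm_eq (L ++ R) (iota 0 n).
Proof.
have e : perm_eq (iota 0 n.+1) (n :: iota 0 n).
  by rewrite -addn1 iotaD /= add0n perm_catC.
by rewrite (permPr e) -cat1s perm_catCA /= perm_cons.
Qed.

(** As [L] lies above [R], sorting each part makes [R ++ L] a sorted rearrangement of [iota 0 n],
    hence [iota 0 n] itself; cut it at [size R]. *)
Lemma perm_iota_split (n : nat) (L R : seq nat) :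
    perm_eq (L ++ n :: R) (iota 0 n.+1) ->
    allrel (fun l r => (r < l)%N) L R ->
  perm_eq R (iota 0 (size R)) /\ perm_eq L (iota (size R) (size L)).
Proof.
move=> pLR /allrelP LR.
have pRL : perm_eq (R ++ L) (iota 0 n).
  by rewrite perm_catC -perm_iota_max.
have sRL : (size R + size L)%N = n.
  by have := perm_size pRL; rewrite size_cat size_iota.
have : sort leq R ++ sort leq L = iota 0 n.
  apply: (sorted_eq leq_trans anti_leq); last 2 first.
  - exact: iota_sorted.
  - rewrite (perm_trans _ pRL) // perm_cat // perm_sort //.
  rewrite sorted_pairwise; last exact: leq_trans.
  rewrite pairwise_cat -!sorted_pairwise; try exact: leq_trans.
  rewrite !(sort_sorted leq_total) !andbT.
  by apply/allrelP => r l; rewrite !mem_sort => rR lL; rewrite ltnW ?LR.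
move=> E.
have ER : sort leq R = iota 0 (size R).
  have := congr1 (take (size R)) E.
  by rewrite take_size_cat ?size_sort // take_iota => ->; congr iota; lia.
have EL : sort leq L = iota (size R) (size L).
  have := congr1 (drop (size R)) E.
  by rewrite drop_size_cat ?size_sort // drop_iota => ->; congr iota; lia.
by split; [rewrite -ER | rewrite -EL]; rewrite perm_sym perm_sort.
Qed.

Lemma perm_iota_join (n : nat) (L R : seq nat) :
    (size L + size R)%N = n -> perm_eq L (iota 0 (size L)) ->
    perm_eq R (iota 0 (size R)) ->
  perm_eq ([seq (size R + v)%N | v <- L] ++ n :: R) (iota 0 n.+1).
Proof.
move=> sLR pL pR.
rewrite perm_iota_max perm_catC -sLR addnC iotaD add0n perm_cat //.
by rewrite -{2}[size R]addn0 iotaDl perm_map.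
Qed.

Definition join_max (n : nat) (L R : seq nat) : seq nat :=
  [seq (size R + v)%N | v <- L] ++ n :: R.

Lemma perm_iota_gt n s : perm_eq s (iota 0 n) -> all (gtn n) s.
Proof. by move=> ps; apply/allP => i; rewrite (perm_mem ps) mem_iota. Qed.

Lemma mem_av_words n s : (s \in av_words n) = perm_eq s (iota 0 n) && av132 s.
Proof. by rewrite mem_filter mem_permutations andbC perm_sym. Qed.

Lemma size_av_word n s : s \in av_words n -> size s = n.
Proof.
by rewrite mem_av_words => /andP[/perm_size-> _]; rewrite size_iota.
Qed.

(** The cut can be read off the joined word, which gives injectivity in [perm_av_wordsS]. *)
Lemma index_join_max n a b L R :
  L \in av_words a -> R \in av_words b -> (a + b)%N = n ->
  index n (join_max n L R) = size L.
Proof.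
move=> La Rb abn; rewrite index_cat size_map /= eqxx addn0 ifN //.
apply/negP => /mapP[v vL nv].
have := La; rewrite mem_av_words => /andP[/perm_iota_gt/allP/(_ _ vL) /=].
rewrite -abn (size_av_word _ _ Rb) addnC in nv.
by move/addnI: nv => <-; rewrite ltnn.
Qed.

Lemma perm_av_wordsS n :
  perm_eq (av_words n.+1)
    [seq join_max n p.1 p.2 | a <- iota 0 n.+1,
       p <- [seq (L, R) | L <- av_words a, R <- av_words (n - a)]].
Proof.
apply: uniq_perm.
- by rewrite filter_uniq ?permutations_uniq.
- apply: allpairs_uniq_dep; first exact: iota_uniq.
    move=> a _.
    apply: allpairs_uniq; rewrite ?filter_uniq ?permutations_uniq //.
    by move=> [? ?] [? ?] _ _; rewrite /uncurry.
  have inP t :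
      t \in [seq @Tagged nat a (fun=> (seq nat * seq nat)%type) p |
        a <- iota 0 n.+1,
        p <- [seq (L, R) | L <- av_words a, R <- av_words (n - a)]] ->
      [/\ (tag t < n.+1)%N, (tagged t).1 \in av_words (tag t)
        & (tagged t).2 \in av_words (n - tag t)].
    case/allpairsPdep => a [p] [ia /allpairsP[[L R] [/= aL aR ->]] ->] /=.
    by rewrite mem_iota in ia; split.
  move=> t t' /inP[tn tL tR] /inP[tn' tL' tR'] e.
  case: t t' tn tL tR tn' tL' tR' e => [a [L R]] [a' [L' R']] /=.
  move=> tn tL tR tn' tL' tR' e.
  have := congr1 (index n) e.
  rewrite (index_join_max _ _ _ _ _ tL tR); last by lia.
  rewrite (index_join_max _ _ _ _ _ tL' tR'); last by lia.
  move=> eL; move: (e); move/eqP.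
  rewrite eqseq_cat ?size_map // eqseq_cons eqxx /=.
  case/andP=> /eqP e1 /eqP e2; move: e1; rewrite e2 => /inj_map e1.
  rewrite (e1 (@addnI _)) {e1}.
  by have -> : a = a' by rewrite -(size_av_word _ _ tL) -(size_av_word _ _ tL').
move=> s; apply/idP/idP; rewrite mem_av_words.
  case/andP=> ps As.
  have ns : n \in s by rewrite (perm_mem ps) mem_iota /=; lia.
  case/splitPr: ns ps As => L R ps As.
  have pLR := ps; rewrite perm_iota_max in pLR.
  have := perm_iota_gt _ _ pLR; rewrite all_cat => /andP[Ln Rn].
  have := As; rewrite av132_split ?(perm_uniq pLR) ?iota_uniq //.
  case/and3P=> AL AR LR.
  have [pR pL] := perm_iota_split _ _ _ ps LR.
  have sLR : (size L + size R)%N = n.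
    by have := perm_size pLR; rewrite size_cat size_iota.
  pose L' := [seq (v - size R)%N | v <- L].
  have eL : L = [seq (size R + v)%N | v <- L'].
    rewrite -map_comp -[LHS]map_id; apply/eq_in_map => v.
    by rewrite (perm_mem pL) mem_iota /=; lia.
  apply/allpairsPdep; exists (size L), (L', R); split.
  - by rewrite mem_iota add0n ltnS -sLR leq_addr.
  - apply: allpairs_f; rewrite mem_av_words; last first.
      by rewrite -sLR addKn pR AR.
    rewrite -(av132_map (size R)) -eL AL andbT.
    rewrite (perm_trans (perm_map _ pL)) //.
    by rewrite -[size R]addn0 iotaDl -map_comp addn0 map_id_in // => v _ /=; lia.
  - by rewrite /join_max /= -eL.
case/allpairsPdep => a [p] [ia /allpairsP[[L R] [/= aL aR ->]] ->] /=.
move: ia; rewrite mem_iota add0n ltnS => /= an.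
have sL := size_av_word _ _ aL; have sR := size_av_word _ _ aR.
move: aL aR; rewrite !mem_av_words -{1}sL -{1}sR => /andP[pL AL] /andP[pR AR].
have sLR : (size L + size R)%N = n by rewrite sL sR subnKC.
have pLR := perm_iota_join _ _ _ sLR pL pR.
rewrite {1}/join_max pLR /=.
have := pLR; rewrite perm_iota_max => pLR'.
have := perm_iota_gt _ _ pLR'; rewrite all_cat => /andP[Ln Rn].
rewrite av132_split ?(perm_uniq pLR') ?iota_uniq // av132_map AL AR /=.
apply/allrelP => l r /mapP[v vL ->] rR.
by have /allP/(_ _ rR) /= := perm_iota_gt _ _ pR; lia.
Qed.

(* Removing the maximum of a 132-avoider leaves two independent 132-avoiders,
   every entry of the left one exceeding every entry of the right one. *)
Lemma shifted_sumS x n c d :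
  shifted_sum x n.+1 c d =
  \sum_(a < n.+1) exc_weight x (n + c) (a + d) *
     (shifted_sum x a (c + (n - a)) d * shifted_sum x (n - a) c (d + a.+1)).
Proof.
rewrite /shifted_sum (perm_big _ (perm_av_wordsS n)).
rewrite big_allpairs_dep -[iota 0 n.+1]/(index_iota 0 n.+1) big_mkord.
apply: eq_bigr => a _; rewrite big_distrlr /= big_allpairs.
rewrite big_distrr /= big_seq [RHS]big_seq; apply: eq_bigr => L aL.
rewrite big_distrr /= big_seq [RHS]big_seq; apply: eq_bigr => R aR.
rewrite /join_max word_weight_cat word_weight_map /= size_map.
rewrite (size_av_word _ _ aL) (size_av_word _ _ aR) addnS (addnC a) (addnC c).
by rewrite mulrCA mulrA.
Qed.
End Decomposition.

(** * From the quadratic recurrence to a linear one *)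

Section LinearRecurrence.
Local Open Scope ring_scope.

Definition num_av (n : nat) : int := (size (av_words n))%:R.

Lemma shifted_sum_low x n c d :
  (n + c <= d)%N -> shifted_sum x n c d = num_av n.
Proof.
move=> ncd; rewrite /shifted_sum big_seq.
under eq_bigr => s.
  rewrite mem_av_words => /andP[/perm_iota_gt sn _].
  rewrite (word_weight_low _ _ _ _ _ sn) //; over.
by rewrite -big_seq big_const_seq count_predT iter_addr_0.
Qed.

Lemma shifted_sum_high x n c d :
  (d + n <= c)%N -> shifted_sum x n c d = (-1) ^+ n * num_av n.
Proof.
move=> ncd; rewrite /shifted_sum big_seq.
under eq_bigr => s sn.
  rewrite word_weight_high (size_av_word _ _ sn) //; over.
by rewrite -big_seq big_const_seq count_predT iter_addr_0 /num_av mulr_natr.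
Qed.

Lemma shifted_sum_shift x n c d e :
  shifted_sum x n (c + e) (d + e) = shifted_sum x n c d.
Proof. by apply: eq_bigr => s _; rewrite word_weight_shift. Qed.

(** This is [shifted_sumS] with positions starting at n + 1, beyond all values, so that every weight
    is 1. *)
Lemma num_avS n :
  num_av n.+1 = \sum_(a < n.+1) num_av a * num_av (n - a).
Proof.
rewrite -(shifted_sum_low 1 _ 0 n.+1) ?addn0 // shifted_sumS.
apply: eq_bigr => a _; have an := ltn_ord a.
rewrite !shifted_sum_low; [|lia|lia].
by rewrite /exc_weight; case: ltnP => [|_]; [lia|case: eqP => [|_]]; rewrite mul1r.
Qed.

(* The coefficient of t^n in C(q t^2), where C is the generating function of
   [num_av]. *)
Definition spread (q : int) (n : nat) : int :=
  if odd n then 0 else q ^+ n./2 * num_av n./2.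

Lemma sum_ord_double (M : nat) (h : nat -> int) :
  \sum_(i < M.*2) h i = \sum_(k < M) (h k.*2 + h k.*2.+1).
Proof.
elim: M => [|M IHM]; first by rewrite !big_ord0.
by rewrite doubleS !big_ord_recr /= IHM addrA.
Qed.

Lemma sum_spread q (m M : nat) (f : nat -> int) : (m <= M.*2)%N ->
  \sum_(i < m) spread q i * f i =
  \sum_(k < M | (k.*2 < m)%N) q ^+ k * num_av k * f k.*2.
Proof.
move=> mM; rewrite (big_ord_widen _ (fun i => spread q i * f i) mM).
rewrite big_mkcond.
rewrite (sum_ord_double M (fun i => if (i < m)%N then spread q i * f i else 0)).
rewrite [RHS]big_mkcond; apply: eq_bigr => k _.
by rewrite /spread /= odd_double /= mul0r if_same addr0 half_double.
Qed.

Lemma spread0 q : spread q 0 = 1.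
Proof. by rewrite /spread /= mul1r. Qed.

Lemma spread1 q : spread q 1 = 0.
Proof. by []. Qed.

(** The coefficient of t^(n+2) in F = 1 + q t^2 F^2, where F = C(q t^2). *)
Lemma spreadSS q n :
  spread q n.+2 = q * \sum_(i < n.+1) spread q i * spread q (n - i).
Proof.
have [on|/negbTE en] := boolP (odd n).
  rewrite {1}/spread /= negbK on big1 ?mulr0 // => i _.
  rewrite /spread oddB ?on; last by rewrite -ltnS.
  by case: odd; rewrite ?mul0r ?mulr0.
have [m ->] : exists m, n = m.*2 by exists n./2; lia.
rewrite (sum_spread q _ m.+1 (fun i => spread q (m.*2 - i))) ?doubleS //.
rewrite {1}/spread /= negbK odd_double doubleK num_avS exprS -mulrA; congr (_ * _).
rewrite mulr_sumr; apply: eq_big => k; first by have := ltn_ord k; lia.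
move=> _; have lk : (k <= m)%N by rewrite -ltnS.
rewrite /spread -doubleB odd_double doubleK -{1}(subnKC lk) exprD; ring.
Qed.

(* The coefficient P_ij of the header. *)
Definition half_sum (x : int) (i j : nat) : int :=
  if odd (i + j) then 0 else shifted_sum x (i + j)./2 i (i + j)./2.

Lemma half_sum0 x j : half_sum x 0 j = spread 1 j.
Proof.
rewrite /half_sum /spread add0n; case: odd => //.
by rewrite shifted_sum_low ?addn0 // expr1n mul1r.
Qed.

(** Only c - d matters, and here it equals i - n = (i - j) / 2. *)
Lemma half_sum_shifted x n i j c d :
  (i + j = n.*2)%N -> (c + n = d + i)%N -> shifted_sum x n c d = half_sum x i j.
Proof.
move=> ij cd; rewrite /half_sum ij odd_double doubleK.
by rewrite -[LHS](shifted_sum_shift _ _ _ _ n) cd !(addnC d) shifted_sum_shift.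
Qed.

(* In each term of [shifted_sumS] one of the two factors has all its entries on
   the same side of the shifted diagonal, so it is a signed count. *)
Lemma half_sumS x i j :
  half_sum x i.+1 j =
  \sum_(l < j)
     spread 1 l * (exc_weight x i (j - l.+1) * half_sum x i (j - l.+1))
  - \sum_(l < i) spread (-1) l * half_sum x (i - l.+1) j.
Proof.
have [oij|eij] := boolP (odd (i.+1 + j)).
  (* In each product, either the index of [spread] or the index sum of [half_sum] is odd. *)
  rewrite /half_sum oij !big1 ?subrr // => l _; have lj := ltn_ord l.
    rewrite {1}/spread; case: ifP => ol; first by rewrite mul0r.
    by rewrite ifT ?mulr0 //; lia.
  rewrite {1}/spread; case: ifP => ol; first by rewrite mul0r.
  by rewrite ifT ?mulr0 //; lia.
have [n en] : exists n, (i.+1 + j = n.+1.*2)%N by exists (i.+1 + j)./2.-1; lia.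
rewrite (sum_spread 1 j n.+1
  (fun l => exc_weight x i (j - l.+1) * half_sum x i (j - l.+1))); last by lia.
rewrite (sum_spread (-1) i n.+1 (fun l => half_sum x (i - l.+1) j)); last by lia.
rewrite -(half_sum_shifted _ n.+1 _ _ i.+1 n.+1) //; last by rewrite addnC.
(* For 2a < i the left factor lies wholly above the diagonal and the maximum has weight -1;
   otherwise the right factor lies wholly below it, and its length becomes the summation index. *)
rewrite shifted_sumS (bigID (fun a : 'I_n.+1 => (a.*2 < i)%N)) /= addrC -sumrN.
congr (_ + _); last first.
  apply: eq_bigr => a ai; have an := ltn_ord a.
  rewrite shifted_sum_high; last by lia.
  rewrite (half_sum_shifted _ _ (i - a.*2.+1) j); [|lia|lia].
  by rewrite /exc_weight ifT; [ring|lia].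
rewrite (reindex_inj rev_ord_inj) /=.
apply: eq_big => k; have kn := ltn_ord k; first by lia.
rewrite subSS => ki.
rewrite [X in _ * (_ * X)]shifted_sum_low; last by lia.
rewrite (half_sum_shifted _ _ i (j - k.*2.+1)); [|lia|lia].
rewrite (_ : n - (n - k) = k)%N; last by lia.
rewrite expr1n (_ : exc_weight _ _ _ = exc_weight x i (j - k.*2.+1)); first by ring.
rewrite /exc_weight (_ : (_ < _ + _)%N = (j - k.*2.+1 < i)%N); last by lia.
by rewrite (_ : (_ + i.+1 == _) = (i == j - k.*2.+1)%N) //; lia.
Qed.
End LinearRecurrence.

(** * Three-term recurrences for complete homogeneous polynomials *)

Section Diagonal.
Local Open Scope ring_scope.

(* The action of the complete homogeneous polynomial h_m(U, V) on P, with U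
   acting on the left and V on the right. *)
Fixpoint hsym {K : pzRingType} (U V P : K) (m : nat) : K :=
  if m is m'.+1 then U * hsym U V P m' + P * V ^+ m else P.

Lemma hsymS {K : pzRingType} (U V P : K) m :
  hsym U V P m.+1 = U * hsym U V P m + P * V ^+ m.+1.
Proof. by []. Qed.

Lemma hsymSr {K : pzRingType} (U V P : K) m :
  hsym U V P m.+1 = hsym U V P m * V + U ^+ m.+1 * P.
Proof.
elim: m => [|m IHm]; first by rewrite /= !expr1 addrC.
rewrite hsymS {1}IHm hsymS mulrDr mulrDl -!mulrA -exprSr addrAC.
by rewrite (mulrA U (U ^+ _)) -exprS.
Qed.

Lemma hsym_mull {K : pzRingType} (U V P A : K) m :
  A * U = U * A -> hsym U V (A * P) m = A * hsym U V P m.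
Proof.
by move=> AU; elim: m => //= m ->; rewrite mulrDr !mulrA AU.
Qed.

Lemma hsym_mulr {K : pzRingType} (U V P B : K) m :
  B * V = V * B -> hsym U V (P * B) m = hsym U V P m * B.
Proof.
move=> BV; elim: m => // m IHm; rewrite !hsymSr IHm mulrDl -!mulrA.
by rewrite BV.
Qed.

(** Write P = A R with A = 1 - U^2. Then S h_m(P) = U h_m(R) and X = R + U R V, while h_(m+1)(P) =
    h_(m+1)(R) - U^2 h_(m+1)(R); unfolding [hsym] in both terms gives the recurrence. *)
Lemma hsym_recl {K : pzRingType} (S T U V E W P : K) :
    S * (1 - U ^+ 2) = U -> T * (1 + V ^+ 2) = V ->
    P = (1 - U ^+ 2) * (E + S * W * T) * (1 + V ^+ 2) ->
  let X := E * (1 + V ^+ 2) + S * ((W + P) * V) in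
  P = - (S * hsym U V P 1) + X /\
  forall m, hsym U V P m.+1 =
    S * (hsym U V P m - hsym U V P m.+2) + X * V ^+ m.+1.
Proof.
move=> SA TB defP X; set A := 1 - U ^+ 2 in SA defP.
pose R := (E + S * W * T) * (1 + V ^+ 2).
have PR : P = A * R by rewrite defP -mulrA.
have AU : A * U = U * A by rewrite mulrBl mulrBr mul1r mulr1 -exprS -exprSr.
have XR : X = R + U * R * V.
  rewrite -SA -(mulrA S A R) -PR /X /R mulrDl mulrDl mulrDr.
  by rewrite -!(mulrA S) -(mulrA W T) TB addrA.
have QR m : hsym U V P m = A * hsym U V R m by rewrite {1}PR hsym_mull.
have SQ m : S * hsym U V P m = U * hsym U V R m by rewrite QR mulrA SA.
have AE (M : K) : A * M = M - U * (U * M) by rewrite mulrBl mul1r expr2 mulrA.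
split=> [|m].
  rewrite SQ {1}PR AE XR hsymS expr1 mulrDr (mulrA U R).
  by rewrite [RHS]addrC [U * (U * R) + _]addrC addrKA.
rewrite mulrBr !SQ QR AE XR.
rewrite (hsymS U V R m.+1) (mulrDr U _ (R * V ^+ m.+2)).
set b := U * (U * hsym U V R m.+1); rewrite hsymS; set a := U * hsym U V R m.
rewrite mulrDl -(mulrA (U * R)) -exprS -(mulrA U).
set c := R * V ^+ m.+1; set d := U * (R * _).
by rewrite -!(addrA a) [- _ + _]addrC (addrC b) addrKA.
Qed.

(** Mirror image of [hsym_recl]: P = R B with B = 1 + V^2, h_m(P) T = h_m(R) V and Z = R - U R V. *)
Lemma hsym_recr {K : pzRingType} (S T U V E W P : K) :
    (1 - U ^+ 2) * S = U -> (1 + V ^+ 2) * T = V ->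
    P = (1 - U ^+ 2) * (E + S * W * T) * (1 + V ^+ 2) ->
  let Z := (1 - U ^+ 2) * E + U * ((W - P) * T) in
  forall m, hsym U V P m.+1 =
    (hsym U V P m + hsym U V P m.+2) * T + U ^+ m.+1 * Z.
Proof.
move=> AS BT defP Z m; set B := 1 + V ^+ 2 in BT defP.
pose R := (1 - U ^+ 2) * (E + S * W * T).
have PR : P = R * B by [].
have BV : B * V = V * B by rewrite mulrDl mulrDr mul1r mulr1 -exprS -exprSr.
have ZR : Z = R - U * (R * V).
  have -> : R * V = P * T by rewrite PR -(mulrA R) BT.
  by rewrite /Z mulrBl mulrBr addrA /R mulrDr !mulrA AS.
have QR k : hsym U V P k = hsym U V R k * B by rewrite {1}PR hsym_mulr.
have QT k : hsym U V P k * T = hsym U V R k * V by rewrite QR -mulrA BT.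
have BE (M : K) : M * B = M + M * V * V by rewrite mulrDr mulr1 expr2 mulrA.
rewrite mulrDl !QT QR BE ZR.
rewrite (hsymSr U V R m.+1) (mulrDl _ (U ^+ m.+2 * R)).
set b := hsym U V R m.+1 * V * V; rewrite hsymSr.
set a := hsym U V R m * V.
rewrite mulrBr mulrA -exprSr (mulrA _ R V).
set c := U ^+ m.+1 * R; set d := _ * R * V.
by rewrite -!(addrA a) -(addrA b) [d + _]addrC addrNK [b + c]addrC.
Qed.
End Diagonal.

(** * Truncated power series as matrices *)

Section Matrices.
Local Open Scope ring_scope.
Context {N : nat}.
Local Notation MN := 'M[int]_N.+1.
Implicit Types (M : MN) (i j k : 'I_N.+1) (f : nat -> nat -> int) (q x : int).

(* A power series in y and z, truncated, is the matrix of its coefficients: the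
   powers of y act on the left by [lshift_mx], those of z on the right by its
   transpose.  [spread_mx q] is the solution u of u = y (1 + q u^2), and
   [spread1_mx q] is u / y. *)
Definition array f : MN := \matrix_(i, j) f i j.
Definition lshift_mx : MN := array (fun a b : nat => (a == b.+1)%:R).
Definition spread_mx q : MN :=
  array (fun a b : nat => if (b < a)%N then spread q (a - b.+1) else 0).
Definition spread1_mx q : MN :=
  array (fun a b : nat => if (b <= a)%N then spread q (a - b) else 0).

Local Notation S := lshift_mx.
Local Notation U := spread_mx.

Lemma lshift_mxE M i k j : i = k.+1 :> nat -> (S * M) i j = M k j.
Proof.
move=> ik; rewrite mxE (bigD1 k) //= mxE ik eqxx mul1r big1 ?addr0 // => l lk.
by rewrite mxE ik eqSS eq_sym (negbTE (_ : nat_of_ord l != k)) ?mul0r.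
Qed.

Lemma lshift_mx0 M i j : i = 0%N :> nat -> (S * M) i j = 0.
Proof.
by move=> i0; rewrite mxE big1 // => l _; rewrite mxE i0 mul0r.
Qed.

Lemma mul_spread_array q f i j :
  (U q * array f) i j = \sum_(l < i) spread q l * f (i - l.+1)%N j.
Proof.
rewrite mxE (eq_bigr (fun l : 'I_N.+1 =>
  if (l < i)%N then spread q (i - l.+1) * f l j else 0)); last first.
  by move=> l _; rewrite !mxE; case: ifP; rewrite ?mul0r.
rewrite -big_mkcond.
rewrite -(big_ord_widen _ (fun l => spread q (i - l.+1) * f l j)) 1?ltnW //.
rewrite (reindex_inj rev_ord_inj) /=; apply: eq_bigr => l _.
by have li := ltn_ord l; congr (spread q _ * _); lia.
Qed.

(** Read along the subdiagonals, this is [spreadSS]. *)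
Lemma spread1_mxE q : 1 + q *: U q ^+ 2 = spread1_mx q.
Proof.
apply/matrixP => i j.
rewrite mxE [in X in _ + X]mxE expr2 mul_spread_array -[1]/(1%:M) !mxE.
have [ij|] := ltnP j i; last first.
  move=> ij; rewrite big1 ?mulr0 ?addr0.
    case: (eqVneq i j) => [->|nij]; first by rewrite leqnn subnn spread0.
    by rewrite ifN // -ltnNge ltn_neqAle ij andbT.
  by move=> l _; rewrite ifF ?mulr0 //; lia.
rewrite ltnW // -val_eqE gtn_eqF // add0r.
case e : (i - j)%N => [|[|n]]; first by lia.
  by rewrite spread1 big1 ?mulr0 // => l _; rewrite ifF ?mulr0 //; lia.
rewrite spreadSS; congr (_ * _).
have ni : (n.+1 <= i)%N by lia.
rewrite (big_ord_widen _ (fun l => spread q l * spread q (n - l)) ni).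
rewrite [RHS]big_mkcond; apply: eq_bigr => l _; case: ifP => lj.
  by rewrite ifT; [congr (_ * spread q _); lia|lia].
by rewrite ifF ?mulr0 //; lia.
Qed.

Lemma lshift_spread1 q : S * spread1_mx q = U q.
Proof.
apply/matrixP => i j; case: (posnP i) => [i0|i0].
  by rewrite lshift_mx0 // mxE i0.
have lt : (i.-1 < N.+1)%N by have := ltn_ord i; lia.
rewrite (lshift_mxE _ _ (Ordinal lt)) /=; last by lia.
rewrite !mxE /= (_ : (j <= i.-1)%N = (j < i)%N); last by lia.
by case: ifP => // ji; congr spread; lia.
Qed.

Lemma spread1_spreadC q : spread1_mx q * U q = U q * spread1_mx q.
Proof.
rewrite -spread1_mxE mulrDl mulrDr mul1r mulr1.
by rewrite -scalerAl -scalerAr -exprS -exprSr.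
Qed.

(** In the other order the product is u/y - q u^2 = 1; a one-sided inverse of a square matrix is
    two-sided. *)
Lemma spread1_mx_inv q : spread1_mx q * (1 - q *: (S * U q)) = 1.
Proof.
apply/mulmx1C; rewrite -mulmxE mulmxBl mul1mx -{1}spread1_mxE.
rewrite -scalemxAl -mulmxA mulmxE -spread1_spreadC.
by rewrite mulrA lshift_spread1 -expr2 addrK.
Qed.

(** Together with [lshift_spread1] this makes y and u/y commute; the inverse of u/y gives it without
    computing entries. *)
Lemma spread1_lshift q : spread1_mx q * S = U q.
Proof.
rewrite -[LHS]mulr1 -(spread1_mx_inv q) mulrA -(mulrA _ S) lshift_spread1.
by rewrite spread1_spreadC -mulrA spread1_mx_inv mulr1.
Qed.

Lemma mul_array_spread q f i j :
  (array f * (U q)^T) i j = \sum_(l < j) spread q l * f i (j - l.+1)%N.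
Proof.
have -> : array f = (array (fun a b : nat => f b a))^T.
  by apply/matrixP => a b; rewrite !mxE.
by rewrite -mulmxE -trmx_mul mxE mulmxE mul_spread_array.
Qed.

Lemma mul_rshiftE M i j k : j = k.+1 :> nat -> (M * S^T) i j = M i k.
Proof.
move=> jk; rewrite -[M]trmxK -mulmxE -trmx_mul mxE mulmxE.
by rewrite (lshift_mxE _ _ k) // !mxE.
Qed.

Lemma mul_rshift0 M i j : j = 0%N :> nat -> (M * S^T) i j = 0.
Proof.
by move=> j0; rewrite -[M]trmxK -mulmxE -trmx_mul mxE mulmxE lshift_mx0.
Qed.

Definition lower M := forall i j, (i < j)%N -> M i j = 0.
Definition upper M := forall i j, (j < i)%N -> M i j = 0.

Lemma lower_add M M' : lower M -> lower M' -> lower (M + M').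
Proof. by move=> lM lM' i j ij; rewrite mxE lM // lM' // addr0. Qed.

Lemma upper_add M M' : upper M -> upper M' -> upper (M + M').
Proof. by move=> lM lM' i j ij; rewrite mxE lM // lM' // addr0. Qed.

Lemma lower_mul M M' : lower M -> lower M' -> lower (M * M').
Proof.
move=> lM lM' i j ij; rewrite mxE big1 // => l _.
have [il|li] := ltnP i l; first by rewrite lM // mul0r.
by rewrite lM' ?mulr0 // (leq_ltn_trans li).
Qed.

Lemma upper_mul M M' : upper M -> upper M' -> upper (M * M').
Proof.
move=> lM lM' i j ij; rewrite mxE big1 // => l _.
have [il|li] := ltnP l i; first by rewrite lM // mul0r.
by rewrite lM' ?mulr0 // (leq_trans ij).
Qed.

Lemma lower_exp M m : lower M -> lower (M ^+ m.+1).
Proof.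
by move=> lM; elim: m => [|m IHm]; rewrite ?expr1 // exprS; apply: lower_mul.
Qed.

Lemma upper_exp M m : upper M -> upper (M ^+ m.+1).
Proof.
by move=> lM; elim: m => [|m IHm]; rewrite ?expr1 // exprS; apply: upper_mul.
Qed.

Lemma upper_mul_diag M M' i :
  upper M -> upper M' -> (M * M') i i = M i i * M' i i.
Proof.
move=> uM uM'; rewrite mxE (bigD1 i) //= big1 ?addr0 // => l li.
have [il|] := ltnP l i; first by rewrite uM // mul0r.
rewrite leq_eqVlt val_eqE eq_sym (negbTE li) /= => il.
by rewrite uM' ?mulr0.
Qed.

(** Multiplication by y z moves entries along diagonals. *)
Lemma lower_shift M : lower M -> lower (S * M * S^T).
Proof.
move=> lM i j ij; rewrite -mulrA.
case: (posnP i) => [i0|i0]; first by rewrite lshift_mx0.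
have li : (i.-1 < N.+1)%N by have := ltn_ord i; lia.
have lj : (j.-1 < N.+1)%N by have := ltn_ord j; lia.
rewrite (lshift_mxE _ _ (Ordinal li)) /=; last by lia.
by rewrite (mul_rshiftE _ _ _ (Ordinal lj)) /= ?lM //=; lia.
Qed.

Lemma upper_shift M : upper M -> upper (S * M * S^T).
Proof.
move=> lM i j ij; case: (posnP j) => [j0|j0]; first by rewrite mul_rshift0.
have li : (i.-1 < N.+1)%N by have := ltn_ord i; lia.
have lj : (j.-1 < N.+1)%N by have := ltn_ord j; lia.
rewrite (mul_rshiftE _ _ _ (Ordinal lj)) /=; last by lia.
by rewrite (lshift_mxE _ _ (Ordinal li)) /= ?lM //=; lia.
Qed.

End Matrices.

(** * The signed ballot recurrence on the diagonal *)

Section DiagonalRecurrence.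
Local Open Scope ring_scope.
Context {N : nat}.
Local Notation MN := 'M[int]_N.+1.
Local Notation S := (@lshift_mx N).
Local Notation U := (@spread_mx N (-1)).
Local Notation V := (@spread_mx N 1)^T.
Local Notation E := (delta_mx 0 0 : MN).

Definition half_sum_mx x : MN := array (half_sum x).
Definition signed_half_sum_mx x : MN :=
  array (fun a b => exc_weight x a b * half_sum x a b).
Local Notation P := half_sum_mx.
Local Notation W := signed_half_sum_mx.

Lemma sub_spread_sqr : 1 - U ^+ 2 = spread1_mx (-1).
Proof. by rewrite -spread1_mxE scaleN1r. Qed.

Lemma add_spread_sqr : 1 + V ^+ 2 = (spread1_mx 1)^T.
Proof.
rewrite -spread1_mxE scale1r linearD /= -[1]/(1%:M) tr_scalar_mx.
by rewrite !expr2 -!mulmxE trmx_mul.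
Qed.

Lemma mul_delta00 (M : MN) i j : (E * M) i j = if i == 0 then M 0 j else 0.
Proof.
rewrite mxE (bigD1 0) //= mxE eqxx andbT big1 ?addr0; last first.
  by move=> l l0; rewrite mxE (negbTE l0) andbF mul0r.
by case: eqP => _; rewrite ?mul1r ?mul0r.
Qed.

(** Row 0 is v/z by [half_sum0]; the other rows are [half_sumS]. *)
Lemma half_sum_mx_rec x :
  P x = E * (spread1_mx 1)^T + S * (W x * V) - S * (U * P x).
Proof.
apply/matrixP => i j.
rewrite [RHS]mxE [in X in _ = _ + X]mxE mxE [in X in X - _]mxE.
rewrite mul_delta00 -val_eqE /=; case: (posnP i) => [i0|i0].
  by rewrite i0 !lshift_mx0 // half_sum0 !mxE /= subn0 addr0 subr0.
have li : (i.-1 < N.+1)%N by have := ltn_ord i; lia.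
rewrite !(lshift_mxE _ _ (Ordinal li)) /=; try lia.
by rewrite mul_array_spread mul_spread_array add0r /= -half_sumS prednK.
Qed.

(** Collecting the terms in P of [half_sum_mx_rec] gives (1 + y u) P, and 1 + y u is inverse to u/y
    = 1 - u^2; on the right, v = z (1 + v^2) lets 1 + v^2 be factored out. *)
Lemma half_sum_mx_factor x :
  P x = (1 - U ^+ 2) * (E + S * W x * S^T) * (1 + V ^+ 2).
Proof.
rewrite sub_spread_sqr add_spread_sqr.
have -> : (spread1_mx (-1) : MN) * (E + S * W x * S^T) * (spread1_mx 1)^T =
  spread1_mx (-1) * (E * (spread1_mx 1)^T + S * (W x * V)).
  rewrite -mulrA mulrDl -!mulrA; congr (_ * (_ + _ * (_ * _))).
  by rewrite -mulmxE -trmx_mul mulmxE spread1_lshift.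
have -> : E * (spread1_mx 1)^T + S * (W x * V) = (1 - (-1) *: (S * U)) * P x.
  by rewrite scaleN1r opprK mulrDl mul1r {1}half_sum_mx_rec -!mulrA subrK.
by rewrite mulrA spread1_mx_inv mul1r.
Qed.

(** D_m(k) of the header, for k <= N; [inord] sends larger k to 0. *)
Definition diag_term x (m k : nat) : int :=
  hsym U V (P x) m.*2 (inord k) (inord k).

Lemma upper_spread1 : upper ((spread1_mx 1)^T : MN).
Proof. by move=> i j ij; rewrite !mxE leqNgt ij. Qed.

Lemma lower_spread1 : lower (spread1_mx (-1) : MN).
Proof. by move=> i j ij; rewrite !mxE leqNgt ij. Qed.

Lemma upper_spread : upper V.
Proof. by move=> i j ij; rewrite !mxE ifN // -leqNgt ltnW. Qed.

Lemma lower_spread : lower U.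
Proof. by move=> i j ij; rewrite !mxE ifN // -leqNgt ltnW. Qed.

Lemma lshift_transpose : S^T * (1 + V ^+ 2) = V /\ (1 + V ^+ 2) * S^T = V.
Proof.
rewrite add_spread_sqr -!mulmxE -!trmx_mul mulmxE.
by rewrite spread1_lshift lshift_spread1.
Qed.

Lemma upper_remainder x :
  E * (1 + V ^+ 2) + S * ((W x + P x) * V) =
  E * (spread1_mx 1)^T + S * ((W x + P x) * (spread1_mx 1)^T) * S^T.
Proof.
have [_ VT] := lshift_transpose; rewrite -{2}VT add_spread_sqr.
by rewrite -!mulrA.
Qed.

(** Below the diagonal the weight is -1, so W + P vanishes there. *)
Lemma upper_remainder_tri x :
  upper (E * (1 + V ^+ 2) + S * ((W x + P x) * V)).
Proof.
rewrite upper_remainder; apply: upper_add.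
  by move=> i j ij; rewrite mul_delta00 ifN // -val_eqE /=; lia.
apply/upper_shift/upper_mul/upper_spread1 => i j ij.
by rewrite !mxE /exc_weight ij mulN1r addNr.
Qed.

(** Above the diagonal the weight is 1, so W - P vanishes there. *)
Lemma lower_remainder_tri x :
  lower ((1 - U ^+ 2) * E + U * ((W x - P x) * S^T)).
Proof.
rewrite sub_spread_sqr -{1}(lshift_spread1 (-1)); apply: lower_add.
  apply: (lower_mul _ _ lower_spread1) => i j ij.
  by rewrite mxE [j == _]negbTE ?andbF // -val_eqE /=; lia.
rewrite mulrA -(mulrA S); apply/lower_shift/lower_mul; first exact: lower_spread1.
by move=> i j ij; rewrite !mxE /exc_weight ltnNge ltnW //= ltn_eqF // mul1r subrr.
Qed.

(** The right recurrence at (i, i + 1): its remainder is lower triangular, and [S^T] moves the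
    column back to i. *)
Lemma hsym_superdiag x m (i j : 'I_N.+1) : j = i.+1 :> nat ->
  hsym U V (P x) m.+1 i j = hsym U V (P x) m i i + hsym U V (P x) m.+2 i i.
Proof.
move=> ij; have [_ VT] := lshift_transpose.
have AS : (1 - U ^+ 2) * S = U by rewrite sub_spread_sqr spread1_lshift.
rewrite (hsym_recr _ _ _ _ _ _ _ AS VT (half_sum_mx_factor x) m).
have lZ := lower_mul _ _ (lower_exp _ m lower_spread) (lower_remainder_tri x).
by rewrite mxE (mul_rshiftE _ _ _ i) // lZ ?ij // addr0 mxE.
Qed.

(** The remainder is upper triangular and V strictly so. *)
Lemma upper_remainder_exp_diag x m i :
  ((E * (1 + V ^+ 2) + S * ((W x + P x) * V)) * V ^+ m.+1) i i = 0.
Proof.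
rewrite upper_mul_diag; [|exact: upper_remainder_tri|exact/upper_exp/upper_spread].
suff -> : (V ^+ m.+1) i i = 0 by rewrite mulr0.
elim: m => [|m IHm]; first by rewrite expr1 !mxE ltnn.
rewrite exprS upper_mul_diag ?IHm ?mulr0 //; first exact: upper_spread.
exact/upper_exp/upper_spread.
Qed.

Lemma diag_term_half_sum x k : (k <= N)%N -> diag_term x 0 k = half_sum x k k.
Proof. by move=> kN; rewrite /diag_term /= mxE inordK. Qed.

Lemma diag_recl x :
  let X := E * (1 + V ^+ 2) + S * ((W x + P x) * V) in
  P x = - (S * hsym U V (P x) 1) + X /\
  forall m, hsym U V (P x) m.+1 =
    S * (hsym U V (P x) m - hsym U V (P x) m.+2) + X * V ^+ m.+1.
Proof.
have [TV _] := lshift_transpose.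
apply: hsym_recl TV (half_sum_mx_factor x).
by rewrite sub_spread_sqr lshift_spread1.
Qed.

Lemma diag_termS0 x m : diag_term x m.+1 0 = 0.
Proof.
have [_ rec] := diag_recl x.
rewrite /diag_term doubleS rec mxE lshift_mx0 ?inordK //.
by rewrite upper_remainder_exp_diag addr0.
Qed.

(** The left recurrence leads from (k + 1, k + 1) to (k, k + 1), and [hsym_superdiag] from there to
    (k, k). The two copies of Q_(2m+2) cancel, so only even indices remain. *)
Lemma diag_termSS x m k : (k < N)%N ->
  diag_term x m.+1 k.+1 = diag_term x m k - diag_term x m.+2 k.
Proof.
move=> kN; have [_ rec] := diag_recl x.
have kk : (inord k.+1 : 'I_N.+1) = (inord k : 'I_N.+1).+1 :> nat.
  by rewrite !inordK; lia.
have sd l := hsym_superdiag x l _ _ kk.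
rewrite /diag_term !doubleS rec mxE upper_remainder_exp_diag addr0.
rewrite (lshift_mxE _ _ _ _ kk).
move: (hsym U V (P x)) sd => Q sd {rec}.
by rewrite mxE [in X in _ + X]mxE !sd addrKA.
Qed.

(** As before, -Q_1 contributes -(D_0 + D_1); the diagonal of W + P adds (x + 1) D_0. *)
Lemma diag_term0S x k : (k < N)%N ->
  diag_term x 0 k.+1 = x * diag_term x 0 k - diag_term x 1 k.
Proof.
move=> kN; have [rec _] := diag_recl x.
have kk : (inord k.+1 : 'I_N.+1) = (inord k : 'I_N.+1).+1 :> nat.
  by rewrite !inordK; lia.
have sd := hsym_superdiag x 0 _ _ kk.
have Q0 : hsym U V (P x) 0 = P x by [].
rewrite /diag_term /double Q0; rewrite Q0 in sd.
move: (hsym U V (P x)) rec sd {Q0} => Q rec sd.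
have addE (M M' : MN) i j : (M + M') i j = M i j + M' i j by rewrite mxE.
have oppE (M : MN) i j : (- M) i j = - M i j by rewrite mxE.
rewrite {1}rec upper_remainder !addE oppE (lshift_mxE _ _ _ _ kk) sd.
have nz : ((inord k.+1 : 'I_N.+1) == 0) = false.
  by apply/eqP => /(congr1 (@nat_of_ord _)); rewrite kk.
rewrite mul_delta00 nz add0r.
rewrite (mul_rshiftE _ _ _ _ kk) (lshift_mxE _ _ _ _ kk).
rewrite upper_mul_diag; last exact: upper_spread1; last first.
  by move=> i j ij; rewrite !mxE /exc_weight ij mulN1r addNr.
rewrite addE ![array _ _ _]mxE [_^T _ _]mxE [array _ _ _]mxE.
rewrite /exc_weight ltnn eqxx leqnn subnn spread0.
ring.
Qed.
End DiagonalRecurrence.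

(** * Solving the ballot recurrences *)

Section ClosedForm.
Local Open Scope ring_scope.

Lemma catalanE m : (catalan m)%:Z = 'C(m.*2, m)%:R - 'C(m.*2, m.+1)%:R.
Proof.
have e : (m.+1 * 'C(m.*2, m.+1) = m * 'C(m.*2, m))%N.
  by rewrite mul_bin_left -addnn addnK.
have e' : ('C(m.*2, m) = ('C(m.*2, m) - 'C(m.*2, m.+1)) * m.+1)%N.
  by rewrite mulnBl (mulnC _ m.+1) (mulnC _ m.+1) e mulSn addnK.
have le : ('C(m.*2, m.+1) <= 'C(m.*2, m))%N by nia.
by rewrite /catalan {1}e' mulnK // -natrB // pmulrn intz.
Qed.

(** D_m(k) counts nonnegative paths of k steps from 0 to m, each of the l down steps carrying a
    sign. Since k = m + 2l, C(k, l + m + 1) is the usual C(k, l - 1), written so that l = 0 causes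
    no truncated subtraction. *)
Lemma ballot_rec0 (N : nat) (D : nat -> nat -> int) :
    (forall m, D m 0%N = (m == 0%N)%:R) ->
    (forall m k, (k < N)%N -> D m.+1 k.+1 = D m k - D m.+2 k) ->
    (forall k, (k < N)%N -> D 0%N k.+1 = - D 1%N k) ->
  forall k m, (k <= N)%N ->
    ((odd (k + m) || (k < m)%N) -> D m k = 0) /\
    (forall l, (k = m + l.*2)%N ->
       D m k = (-1) ^+ l * ('C(k, l)%:R - 'C(k, l + m.+1)%:R)).
Proof.
move=> D0 DS D1; elim=> [|k IHk] m kN.
  split=> [h|l e]; first by rewrite D0; case: m h.
  have [-> ->] : m = 0%N /\ l = 0%N by lia.
  by rewrite D0 /= bin0n expr0 mul1r subr0.
case: m => [|m]; split=> [h|[|l] e].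
- by rewrite D1 // (IHk 1%N _).1 ?oppr0 //; lia.
- lia.
- rewrite D1 // ((IHk 1%N _).2 l); [|lia|lia].
  rewrite exprS addn1 addn2 !binS !natrD; ring.
- by rewrite DS // (IHk m _).1 ?(IHk m.+2 _).1 ?subrr //; lia.
- rewrite DS // (IHk m.+2 _).1; [|lia|lia].
  rewrite ((IHk m _).2 0%N); [|lia|lia].
  by rewrite !bin0 !bin_small //; lia.
- rewrite DS // ((IHk m _).2 l.+1); [|lia|lia].
  rewrite ((IHk m.+2 _).2 l); [|lia|lia].
  by rewrite exprS !addSn !addnS !binS !natrD; ring.
Qed.

(** Flat steps at height 0 now have weight 1, so both parities of k + 1 - m occur, recorded by [b].
    The binomials are taken at k, hence the formula starts at time k + 1. *)
Lemma ballot_rec1 (N : nat) (D : nat -> nat -> int) :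
    (forall m, D m 0%N = (m == 0%N)%:R) ->
    (forall m k, (k < N)%N -> D m.+1 k.+1 = D m k - D m.+2 k) ->
    (forall k, (k < N)%N -> D 0%N k.+1 = D 0%N k - D 1%N k) ->
  forall k m, (k < N)%N ->
    ((k.+1 < m)%N -> D m k.+1 = 0) /\
    (forall l (b : bool), (k.+1 = m + l.*2 + b)%N ->
       D m k.+1 = (-1) ^+ l * ('C(k, l)%:R - 'C(k, l + m + b)%:R)).
Proof.
move=> D0 DS D1; elim=> [|k IHk] m kN.
  split=> [h|l b e]; first by case: m h => [//|[//|m]] _; rewrite DS // !D0.
  case: m e => [|[|m]] e; last by lia.
    have [-> ->] : l = 0%N /\ b = true by case: b e => //=; lia.
    by rewrite D1 // !D0.
  have [-> ->] : l = 0%N /\ b = false by case: b e => //=; lia.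
  by rewrite DS // !D0.
case: m => [|m]; split=> [h|[|l] b e].
- by [].
- by case: b e => //=; lia.
- rewrite D1 //; case: b e => /= e.
    rewrite ((IHk 0%N _).2 l.+1 false) /=; [|lia|lia].
    rewrite ((IHk 1%N _).2 l true) /=; [|lia|lia].
    by rewrite exprS !addn0 !addn1 !binS !natrD; ring.
  (* At the previous time D_0 and D_1 agree, so both sides are 0. *)
  rewrite ((IHk 0%N _).2 l true) /=; [|lia|lia].
  rewrite ((IHk 1%N _).2 l false) /=; [|lia|lia].
  by rewrite !addn0 !addn1 subrr; ring.
- by rewrite DS ?(IHk m _).1 ?(IHk m.+2 _).1 ?subrr //; lia.
- rewrite DS // (IHk m.+2 _).1; [|lia|lia].
  rewrite ((IHk m _).2 0%N b); [|lia|lia].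
  by rewrite !bin0 !bin_small //; lia.
- rewrite DS // ((IHk m _).2 l.+1 b); [|lia|lia].
  rewrite ((IHk m.+2 _).2 l b); [|lia|lia].
  by rewrite exprS !addSn !addnS !addSn !binS !natrD; ring.
Qed.

Lemma shifted_sum_diag x n : shifted_sum x n 0 0 = @diag_term n x 0 n.
Proof.
by rewrite diag_term_half_sum // (half_sum_shifted _ _ n n) ?addnn.
Qed.

Lemma diag_term_init N x m : @diag_term N x m 0 = (m == 0%N)%:R.
Proof.
by case: m => [|m]; rewrite ?diag_termS0 // diag_term_half_sum // half_sum0 spread0.
Qed.

Lemma shifted_sum_der n :
  shifted_sum 0 n 0 0 = if odd n then 0 else (-1) ^+ n./2 * (catalan n./2)%:Z.
Proof.
have [odd0 even0] := ballot_rec0 n (@diag_term n 0) (diag_term_init n 0)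
  (fun m k => @diag_termSS n 0 m k)
  (fun k kn => etrans (@diag_term0S n 0 k kn) ltac:(by rewrite mul0r add0r))
  n 0%N (leqnn n).
rewrite shifted_sum_diag; case: ifP => on; first by rewrite odd0 // addn0 on.
have e : n = n./2.*2 by lia.
by rewrite (even0 n./2) // catalanE addn1 -e.
Qed.

Lemma shifted_sum_all n : (0 < n)%N ->
  shifted_sum 1 n 0 0 = if odd n then (-1) ^+ n./2 * (catalan n./2)%:Z else 0.
Proof.
case: n => // n _.
have [_ sum1] := ballot_rec1 n.+1 (@diag_term n.+1 1) (diag_term_init n.+1 1)
  (fun m k => @diag_termSS n.+1 1 m k)
  (fun k kn => etrans (@diag_term0S n.+1 1 k kn) ltac:(by rewrite mul1r))
  n 0%N (leqnn n.+1).
rewrite shifted_sum_diag; case: ifP => on.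
  have e : n = n.+1./2.*2 by lia.
  rewrite (sum1 n.+1./2 true) ?catalanE ?addn0 ?addn1 -?e //; lia.
rewrite (sum1 n.+1./2 false); last by lia.
rewrite !addn0 subrr mulr0 //.
Qed.
End ClosedForm.

(** * From words to permutations, and the symmetry between 213 and 132 *)

Section Permutations.
Local Open Scope ring_scope.

Lemma contains132P n (pi : {perm 'I_n}) :
  reflect (exists i j k : 'I_n,
             [/\ (i < j)%N, (j < k)%N, (pi i < pi k)%N & (pi k < pi j)%N])
          (contains_pattern pat132 pi).
Proof.
apply: (iffP existsP) => [[[[|i [|j [|k []]]] //= sz]]|[i [j [k [ij jk ik kj]]]]].
  rewrite andbT => /andP[/andP[ij jk] /forallP h].
  exists i, j, k; split => //.
    by have /forallP/(_ (@Ordinal 3 2 isT))/eqP := h (@Ordinal 3 0 isT).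
  by have /forallP/(_ (@Ordinal 3 1 isT))/eqP := h (@Ordinal 3 2 isT).
exists [tuple i; j; k]; rewrite /= ij jk /=.
apply/forallP => -[[|[|[|//]]] ?]; apply/forallP => -[[|[|[|//]]] ?] /=;
  rewrite !(tnth_nth i) /=; apply/eqP; lia.
Qed.

Lemma contains213P n (pi : {perm 'I_n}) :
  reflect (exists i j k : 'I_n,
             [/\ (i < j)%N, (j < k)%N, (pi j < pi i)%N & (pi i < pi k)%N])
          (contains_pattern pat213 pi).
Proof.
apply: (iffP existsP) => [[[[|i [|j [|k []]]] //= sz]]|[i [j [k [ij jk ji ik]]]]].
  rewrite andbT => /andP[/andP[ij jk] /forallP h].
  exists i, j, k; split => //.
    by have /forallP/(_ (@Ordinal 3 0 isT))/eqP := h (@Ordinal 3 1 isT).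
  by have /forallP/(_ (@Ordinal 3 2 isT))/eqP := h (@Ordinal 3 0 isT).
exists [tuple i; j; k]; rewrite /= ij jk /=.
apply/forallP => -[[|[|[|//]]] ?]; apply/forallP => -[[|[|[|//]]] ?] /=;
  rewrite !(tnth_nth i) /=; apply/eqP; lia.
Qed.

Lemma av132P s :
  reflect (forall i j k, (i < j)%N -> (j < k)%N -> (k < size s)%N ->
             ~~ (nth 0 s i < nth 0 s k < nth 0 s j)%N)
          (av132 s).
Proof.
elim: s => [|v s IHs] /=; first by left.
apply: (iffP andP) => [[/(pairwiseP 0%N) pw /IHs h] i [|j] [|k] // | h].
  case: i => [|i] /=; rewrite !ltnS => ij jk ks; last exact: h.
  by apply: pw; rewrite ?inE //; apply: ltn_trans ks.
split.
  apply/(pairwiseP 0%N) => j k; rewrite !inE => js ks jk.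
  exact: (h 0%N j.+1 k.+1).
by apply/IHs => i j k ij jk ks; apply: (h i.+1 j.+1 k.+1).
Qed.

Definition perm_word {n} (pi : {perm 'I_n}) : seq nat :=
  [seq val (pi i) | i <- enum 'I_n].

Lemma size_perm_word n (pi : {perm 'I_n}) : size (perm_word pi) = n.
Proof. by rewrite size_map size_enum_ord. Qed.

Lemma nth_perm_word n (pi : {perm 'I_n}) (i : 'I_n) :
  nth 0%N (perm_word pi) i = pi i.
Proof. by rewrite (nth_map i) ?size_enum_ord // nth_ord_enum. Qed.

Lemma perm_word_inj n : injective (@perm_word n).
Proof.
move=> s t est; apply/permP => i; apply: val_inj.
by rewrite /= -!nth_perm_word est.
Qed.

Lemma perm_word_iota n (pi : {perm 'I_n}) : perm_eq (perm_word pi) (iota 0 n).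
Proof.
rewrite -val_enum_ord /perm_word map_comp perm_map //.
apply: uniq_perm => [||i]; rewrite ?(map_inj_uniq (@perm_inj _ pi)) ?enum_uniq //.
rewrite mem_enum; apply/mapP; exists (pi^-1%g i); first by rewrite mem_enum.
by rewrite permKV.
Qed.

(** Both lists are duplicate-free of length n!, so one inclusion suffices. *)
Lemma perm_words n :
  perm_eq [seq perm_word pi | pi <- enum {perm 'I_n}]
          (permutations (iota 0 n)).
Proof.
have us : uniq [seq perm_word pi | pi <- enum {perm 'I_n}].
  by rewrite map_inj_uniq ?enum_uniq //; apply: perm_word_inj.
apply: uniq_perm => //; first exact: permutations_uniq.
apply: (uniq_min_size us _ _).2 => [s /mapP[pi _ ->]|].
  by rewrite mem_permutations perm_word_iota.
rewrite size_permutations ?iota_uniq // size_iota size_map.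
by rewrite -cardE card_Sn.
Qed.

Lemma av132_perm_word n (pi : {perm 'I_n}) :
  av132 (perm_word pi) = avoids pat132 pi.
Proof.
apply/av132P/idP => [h|].
  apply/contains132P => -[i [j [k [ij jk ik kj]]]].
  have := h i j k ij jk; rewrite size_perm_word ltn_ord !nth_perm_word ik kj.
  by move/(_ isT).
move/contains132P => h i j k ij jk; rewrite size_perm_word => kn.
have jn := ltn_trans jk kn; have i_n := ltn_trans ij jn.
rewrite (nth_perm_word _ pi (Ordinal kn)) (nth_perm_word _ pi (Ordinal jn)).
rewrite (nth_perm_word _ pi (Ordinal i_n)); apply/negP => /andP[ik kj].
by apply: h; exists (Ordinal i_n), (Ordinal jn), (Ordinal kn).
Qed.

Lemma word_weight_prod x c d s :
  word_weight x c d s =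
  \prod_(i < size s) exc_weight x (nth 0%N s i + c) (i + d).
Proof.
elim: s d => [|v s IHs] d /=; first by rewrite big_ord0.
rewrite big_ord_recl /= IHs; congr (_ * _).
by apply: eq_bigr => i _; rewrite /bump /= addnS.
Qed.

Lemma word_weight_perm x n (pi : {perm 'I_n}) :
  word_weight x 0 0 (perm_word pi) = \prod_(i < n) exc_weight x (pi i) i.
Proof.
rewrite word_weight_prod size_perm_word.
by apply: eq_bigr => i _; rewrite nth_perm_word !addn0.
Qed.

Lemma prod_exc_weight1 n (pi : {perm 'I_n}) :
  \prod_(i < n) exc_weight 1 (pi i) i = (-1) ^+ exc pi.
Proof.
rewrite /exc -prodr_const [RHS]big_mkcond /=; apply: eq_bigr => i _.
by rewrite inE /exc_weight if_same.
Qed.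

Lemma prod_exc_weight0 n (pi : {perm 'I_n}) :
  \prod_(i < n) exc_weight 0 (pi i) i =
  if derangement pi then (-1) ^+ exc pi else 0.
Proof.
case: ifP => [/forallP der|/negbT].
  rewrite -prod_exc_weight1; apply: eq_bigr => i _.
  by rewrite /exc_weight (val_eqE (pi i)) (negbTE (der i)).
rewrite negb_forall => /existsP[i]; rewrite negbK => /eqP fi.
by rewrite (bigD1 i) //= {1}/exc_weight fi ltnn eqxx mul0r.
Qed.

Lemma shifted_sum_perm x n :
  shifted_sum x n 0 0 =
  \sum_(pi : {perm 'I_n} | avoids pat132 pi)
     \prod_(i < n) exc_weight x (pi i) i.
Proof.
rewrite /shifted_sum big_filter -(perm_big _ (perm_words n)).
rewrite big_map big_enum_cond.
by apply: eq_big => pi; rewrite /= ?av132_perm_word ?word_weight_perm.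
Qed.

Lemma sgn_exc_sum_shifted n : sgn_exc_sum n pat132 = shifted_sum 1 n 0 0.
Proof.
by rewrite shifted_sum_perm; apply: eq_bigr => pi _; rewrite prod_exc_weight1.
Qed.

Lemma sgn_exc_sum_der_shifted n : sgn_exc_sum_der n pat132 = shifted_sum 0 n 0 0.
Proof.
rewrite shifted_sum_perm /sgn_exc_sum_der big_mkcondr.
by apply: eq_bigr => pi _; rewrite prod_exc_weight0.
Qed.

(** Reflection of the graph in the antidiagonal: the point (p, v) goes to (n-1-v, n-1-p), on the
    same side of the main diagonal. *)
Definition rc_inv {n} (pi : {perm 'I_n}) : {perm 'I_n} :=
  (perm (@rev_ord_inj n) * pi^-1 * perm (@rev_ord_inj n))%g.

Lemma rc_invE n (pi : {perm 'I_n}) i :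
  rc_inv pi i = rev_ord (pi^-1%g (rev_ord i)).
Proof. by rewrite !permM !permE. Qed.

Lemma rc_invK n : involutive (@rc_inv n).
Proof.
move=> pi; apply/permP => i; rewrite rc_invE; apply: (canLR rev_ordK).
apply: (@perm_inj _ (rc_inv pi)); rewrite permKV rc_invE.
by rewrite rev_ordK permK.
Qed.

Lemma contains132_rc_inv n (pi : {perm 'I_n}) :
  contains_pattern pat132 (rc_inv pi) -> contains_pattern pat213 pi.
Proof.
case/contains132P => i [j [k [ij jk]]]; rewrite !rc_invE /= => ik kj.
apply/contains213P.
(* The reflected points in order of position, which reverses the order of the values of
   [rc_inv pi]. *)
exists (pi^-1%g (rev_ord j)), (pi^-1%g (rev_ord k)), (pi^-1%g (rev_ord i)).
by rewrite !permKV /=; have := ltn_ord k; split; lia.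
Qed.

Lemma contains213_rc_inv n (pi : {perm 'I_n}) :
  contains_pattern pat213 (rc_inv pi) -> contains_pattern pat132 pi.
Proof.
case/contains213P => i [j [k [ij jk]]]; rewrite !rc_invE /= => ji ik.
apply/contains132P.
exists (pi^-1%g (rev_ord k)), (pi^-1%g (rev_ord i)), (pi^-1%g (rev_ord j)).
by rewrite !permKV /=; have := ltn_ord k; split; lia.
Qed.

Lemma avoids_rc_inv n (pi : {perm 'I_n}) :
  avoids pat213 (rc_inv pi) = avoids pat132 pi.
Proof.
congr (~~ _); apply/idP/idP => [/contains213_rc_inv //|h].
by apply: contains132_rc_inv; rewrite rc_invK.
Qed.

(** The map sending j to [rev_ord (pi j)] carries the excedances of [pi] onto those of
    [rc_inv pi]. *)
Lemma exc_rc_inv n (pi : {perm 'I_n}) : exc (rc_inv pi) = exc pi.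
Proof.
rewrite /exc -[RHS](card_imset _ (inj_comp rev_ord_inj (@perm_inj _ pi))).
apply: eq_card => i; rewrite inE; apply/idP/imsetP => [h|[j]].
  exists (pi^-1%g (rev_ord i)); last by rewrite /= permKV rev_ordK.
  rewrite inE permKV; move: h; rewrite rc_invE /=.
  by have := ltn_ord (pi^-1%g (rev_ord i)); have := ltn_ord i; lia.
rewrite inE => h ->; rewrite rc_invE /= rev_ordK permK /=.
by have := ltn_ord (pi j); lia.
Qed.

Lemma derangement_rc_inv n (pi : {perm 'I_n}) :
  derangement (rc_inv pi) = derangement pi.
Proof.
suff h (s : {perm 'I_n}) : derangement s -> derangement (rc_inv s).
  by apply/idP/idP => [/h|/h //]; rewrite rc_invK.
move/forallP => der; apply/forallP => i; rewrite rc_invE.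
apply: contraNneq (der (s^-1%g (rev_ord i))) => e.
by rewrite permKV -[X in _ == X]rev_ordK e.
Qed.

Lemma sgn_exc_sum_213 n : sgn_exc_sum n pat213 = sgn_exc_sum n pat132.
Proof.
rewrite /sgn_exc_sum (reindex_inj (inv_inj (@rc_invK n))).
by apply: eq_big => pi; rewrite ?avoids_rc_inv ?exc_rc_inv.
Qed.

Lemma sgn_exc_sum_der_213 n : sgn_exc_sum_der n pat213 = sgn_exc_sum_der n pat132.
Proof.
rewrite /sgn_exc_sum_der (reindex_inj (inv_inj (@rc_invK n))).
by apply: eq_big => pi; rewrite ?avoids_rc_inv ?derangement_rc_inv ?exc_rc_inv.
Qed.

End Permutations.

Theorem theorem5p9 (n : nat) : (1 <= n)%N ->
  [/\ sgn_exc_sum n pat213 = sgn_exc_sum n pat132,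
      sgn_exc_sum n pat132 =
        (if odd n then (-1) ^+ n./2 * (catalan n./2)%:Z else 0)%R,
      sgn_exc_sum_der n pat213 = sgn_exc_sum_der n pat132
    & sgn_exc_sum_der n pat132 =
        (if odd n then 0 else (-1) ^+ n./2 * (catalan n./2)%:Z)%R].
Proof.
move=> n_gt0; split.
- exact: sgn_exc_sum_213.
- by rewrite sgn_exc_sum_shifted shifted_sum_all.
- exact: sgn_exc_sum_der_213.
- by rewrite sgn_exc_sum_der_shifted shifted_sum_der.
Qed.
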